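(* Let $n,b$ be integers with $b>3$ and $n\ge b+5$, and write $n=p(b+4)+q$ with integers $p\ge 0$ and $0\le q\le b+3$. Then \[ \mathrm{ex}(n, S_{3,b}) = \begin{cases} (p-1)\binom{b+4}{2} + \left\lfloor \dfrac{b(b+4+q)}{2} \right\rfloor, & \text{if } b \geq 24 \text{ and } 4 \leq q \leq b-4,\ \text{or if } 16 \leq b \leq 23 \text{ and } 5 \leq q \leq b-4,\ \text{or if } 14 \leq b \leq 15 \text{ and } 6 \leq q \leq b-5;\\[6pt] (p-1)\binom{b+4}{2} + \left\lfloor \dfrac{b(2b+1)+3}{2} \right\rfloor, & \text{if } b\ge 22 \text{ and } q = b-3; \\[6pt] (p-1)\binom{b+4}{2} + \left\lfloor \dfrac{b(2b+2)+2 + \lfloor b/2 \rfloor}{2} \right\rfloor, & \text{if } b\ge 34 \text{ and } q = b-2; \\[6pt] p\binom{b+4}{2} + \binom{q}{2}, & \text{otherwise}. \end{cases} \]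
   Context: All graphs are finite, simple and undirected. For integers $a,b\ge 0$, the double star $S_{a,b}$ is the tree consisting of a central edge $uv$ together with $a$ further leaves adjacent to $u$ and $b$ further leaves adjacent to $v$. A graph $G$ is $F$-free if it contains no subgraph isomorphic to $F$. The Turán number $\mathrm{ex}(n,F)$ is the maximum number of edges in an $F$-free graph on $n$ vertices. *)

(* Defs.v *)
From HB Require Import structures.
From mathcomp Require Import all_boot.

Set Implicit Arguments.
Unset Strict Implicit.
Unset Printing Implicit Defensive.

Section Graph.
Variable T : finType.

Record graph := Graph {
  edges : {set {set T}};
  edges_card2 : [forall e in edges, #|e| == 2]
}.

HB.instance Definition _ := [isSub for edges].
HB.instance Definition _ := [Finite of graph by <:].

Definition adj (G : graph) : rel T := [rel x y | [set x; y] \in edges G].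

End Graph.

Definition contains (S T : finType) (F : graph S) (G : graph T) : bool :=
  [exists f : {ffun S -> T},
    injectiveb f && [forall x, forall y, adj F x y ==> adj G (f x) (f y)]].

Definition is_free (S T : finType) (F : graph S) (G : graph T) : bool :=
  ~~ contains F G.

(* If no graph on n vertices is F-free (possible only for edgeless F), this
   maximum is 0. *)
Definition ex (n : nat) (S : finType) (F : graph S) : nat :=
  \max_(G : graph 'I_n | is_free F G) #|edges G|.

Section DoubleStar.
Variables a b : nat.

(* The centers u and v are inl None and inr None; the leaves at u are the
   inl (Some i), those at v are the inr (Some j). *)
Definition double_star_vertex : finType := (option 'I_a + option 'I_b)%type.

Definition double_star_u : double_star_vertex := inl None.
Definition double_star_v : double_star_vertex := inr None.
Definition double_star_uleaf (i : 'I_a) : double_star_vertex := inl (Some i).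
Definition double_star_vleaf (j : 'I_b) : double_star_vertex := inr (Some j).

Definition double_star_edges : {set {set double_star_vertex}} :=
  [set double_star_u; double_star_v]
    |: ([set [set double_star_u; double_star_uleaf i] | i : 'I_a]
        :|: [set [set double_star_v; double_star_vleaf j] | j : 'I_b]).

Lemma double_star_edges_card2 :
  [forall e in double_star_edges, #|e| == 2].
Proof.
apply/forall_inP => e; rewrite !inE => /or3P[/eqP-> | /imsetP[i _ ->] | /imsetP[j _ ->]];
by rewrite cards2.
Qed.

Definition double_star : graph double_star_vertex :=
  Graph double_star_edges_card2.

End DoubleStar.

(* Main.v *)
Require Import Defs.
From mathcomp Require Import all_boot.
From mathcomp Require Import zify.

Set Implicit Arguments.
Unset Strict Implicit.
Unset Printing Implicit Defensive.

(** A graph is [S_{3,b}]-free iff [|N(u) :|: N(v)| <= b + 4] for every edge [uv]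
with [d(u) >= 4] and [d(v) > b].

Upper bound: a set [A] of [b + 4] vertices meeting at most [C(b + 4, 2)] edges
can be deleted, which lowers [p] by one. If there is no such [A], all degrees
are at most [b + 1], and every vertex [v] of degree [b + 1] ("big") belongs to a
cluster: all big vertices of [N[v]] have the same closed neighbourhood as [v],
and each other vertex of [N[v]] has at most two neighbours outside. For
[p >= 2] the bound [b + 1] on the degrees is already enough. For [p = 1], let
[k] be the number of big vertices of one cluster: counting edges across the
border of [N[v]] gives a bound on the degree sum that decreases with [k], while
[b n + k] is a bound if there is no other cluster. A second cluster would have
to meet [N[v]] in vertices of degree at most [b / 2], which costs more than it
brings.

Lower bound: disjoint copies of [K_(b+4)], together with a clique, a nearly
[b]-regular graph, or (for [q = b - 3] and [q = b - 2]) a graph made of [k] big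
vertices joined to each other and to a nearly [(w - 4)]-regular graph on
[w = b + 2 - k] vertices, each of which has two more neighbours in a clique. *)

(** * Freeness in terms of neighbourhoods *)

Definition nbr (T : finType) (e : rel T) (x : T) : {set T} := [set y | e x y].

Definition dstar_free (T : finType) (b : nat) (e : rel T) : Prop :=
  forall u v, e u v -> 3 < #|nbr e u| -> b < #|nbr e v| ->
  #|nbr e u :|: nbr e v| <= b + 4.

Lemma adj_sym (T : finType) (G : graph T) : symmetric (adj G).
Proof. by move=> x y; rewrite /adj /= setUC. Qed.

Lemma adj_irr (T : finType) (G : graph T) : irreflexive (adj G).
Proof.
move=> x; apply/negP => /= xG.
by move/forall_inP: (edges_card2 G) => /(_ _ xG); rewrite setUid cards1.
Qed.

Lemma adj_handshake (T : finType) (G : graph T) :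
  \sum_(x : T) #|nbr (adj G) x| = 2 * #|edges G|.
Proof.
have -> : \sum_(x : T) #|nbr (adj G) x| =
    \sum_(x : T) \sum_(y : T) \sum_(E in edges G) ([set x; y] == E).
  apply: eq_bigr => x _; rewrite -sum1_card big_mkcond /=.
  apply: eq_bigr => y _; rewrite inE /=.
  case: ifP => [xyG | /negP xyG].
    rewrite (bigD1 [set x; y]) /=; last by [].
    rewrite eqxx big1 // => E /andP[_].
    by rewrite eq_sym => /negbTE->.
  rewrite big1 // => E EG; case: eqP => // EE; by rewrite -EE in EG.
under eq_bigr => x _ do rewrite exchange_big.
rewrite exchange_big mulnC -sum_nat_const; apply: eq_bigr => E EG.
have /cards2P[a [c [ac ->]]] : #|E| == 2.
  by move/forall_inP: (edges_card2 G); apply.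
rewrite (bigD1 a) //= [X in _ + X](bigD1 c) /=; last by rewrite eq_sym.
rewrite [X in _ + (_ + X)]big1 ?addn0; last first.
  move=> x /andP[xa xc]; rewrite big1 // => y _; case: eqP => // /setP/(_ x).
  by rewrite !inE eqxx (negbTE xa) (negbTE xc).
have one (u v : T) : u != v ->
    \sum_(y : T) ([set u; y] == [set u; v] : nat) = 1.
  move=> uv; rewrite (bigD1 v) //= eqxx big1 // => y yv.
  case: eqP => // /setP/(_ v).
  by rewrite !inE eqxx orbT eq_sym [v == y]eq_sym (negbTE uv) (negbTE yv).
by rewrite one // [[set a; c]]setUC one // eq_sym.
Qed.

Lemma nbr_closed_cover (T : finType) (e : rel T) (u v : T) : symmetric e ->
  e u v -> u |: (v |: (nbr e u :|: nbr e v)) = nbr e u :|: nbr e v.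
Proof.
move=> sym uv; apply/setP => x; rewrite !inE.
by case: eqP => [->|_]; [rewrite (sym v) uv orbT | case: eqP => // ->; rewrite uv].
Qed.

Lemma exists_subset_card (T : finType) (A : {set T}) (k : nat) :
  k <= #|A| -> exists2 B : {set T}, B \subset A & #|B| = k.
Proof.
move=> kA; exists [set x in take k (enum A)].
  by apply/subsetP => x; rewrite inE => /mem_take; rewrite mem_enum.
rewrite cardsE (card_uniqP (take_uniq _ (enum_uniq _))) size_takel //.
by rewrite -cardE.
Qed.

Lemma card_setUD (T : finType) (A B : {set T}) :
  #|A :|: B| = #|A :\: B| + #|B|.
Proof.
by rewrite cardsU; have := cardsID B A; have := subset_leq_card (subsetIr A B); lia.
Qed.

(** This is Hall's condition for two sets. [U] is taken from [X :\: Y] as far as possible, so that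
    only the shortfall uses up elements of [Y]. *)
Lemma exists_disjoint_subsets (T : finType) (X Y : {set T}) (a b : nat) :
  a <= #|X| -> b <= #|Y| -> a + b <= #|X :|: Y| ->
  exists U V : {set T}, [/\ U \subset X, V \subset Y, [disjoint U & V],
    #|U| = a & #|V| = b].
Proof.
move=> aX bY abXY.
have cXY := card_setUD X Y.
case: (leqP a #|X :\: Y|) => aXY.
  have [U sU cU] := exists_subset_card aXY.
  have [V sV cV] := exists_subset_card bY.
  exists U, V; split => //; first exact: subset_trans sU (subsetDl _ _).
  rewrite -setI_eq0; apply/eqP/setP => x; rewrite !inE; apply/negP => /andP[xU xV].
  by have := subsetP sU _ xU; rewrite inE (subsetP sV).
have [Z sZ cZ] : exists2 Z : {set T}, Z \subset X :&: Y & #|Z| = a - #|X :\: Y|.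
  by apply: exists_subset_card; have := cardsID Y X; lia.
set U := Z :|: (X :\: Y).
have cU : #|U| = a.
  rewrite /U cardsU cZ.
  have -> : Z :&: (X :\: Y) = set0.
    apply/setP => x; rewrite !inE; apply/negP => /and3P[xZ xY _].
    by have := subsetP sZ _ xZ; rewrite inE (negbTE xY) andbF.
  rewrite cards0; lia.
have [V sV cV] : exists2 V : {set T}, V \subset Y :\: U & #|V| = b.
  apply: exists_subset_card.
  have := cardsID U Y; have -> : Y :&: U = Z.
    apply/setP => x; rewrite !inE; case xZ: (x \in Z) => /=.
      by have := subsetP sZ _ xZ; rewrite inE => /andP[_ ->].
    by case: (x \in Y).
  lia.
exists U, V; split => //.
- rewrite subUset subsetDl andbT; exact: subset_trans sZ (subsetIl _ _).
- exact: subset_trans sV (subsetDl _ _).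
- rewrite disjoint_sym -setI_eq0; apply/eqP/setP => x; rewrite in_set0 in_setI.
  by apply/negP => /andP[/(subsetP sV)]; rewrite in_setD => /andP[/negbTE->].
Qed.

Lemma set2_eq (T : finType) (x y s t : T) : [set x; y] = [set s; t] ->
  (x = s /\ y = t) \/ (x = t /\ y = s).
Proof.
move=> E.
have /set2P xE : x \in [set s; t] by rewrite -E set21.
have /set2P yE : y \in [set s; t] by rewrite -E set22.
have /set2P sE : s \in [set x; y] by rewrite E set21.
have /set2P tE : t \in [set x; y] by rewrite E set22.
by case: xE => ?; case: yE => ?; case: sE => ?; case: tE => ?; subst; auto.
Qed.

Lemma exists_inj_ord (T : finType) (A : {set T}) (k : nat) : #|A| = k ->
  exists2 f : 'I_k -> T, injective f & forall i, f i \in A.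
Proof.
move=> <-; exists (@enum_val _ (mem A)); [exact: enum_val_inj | exact: enum_valP].
Qed.

(** If the two neighbourhoods together had [b + 5] elements, then without the two centres [b + 3]
    would remain, enough to choose three leaves at [u] and [b] leaves at [v] disjointly. *)
Lemma is_free_dstar_free (T : finType) (b : nat) (G : graph T) :
  is_free (double_star 3 b) G -> dstar_free b (adj G).
Proof.
move=> Gfree u v uv du dv; rewrite leqNgt; apply: contra Gfree => big.
set X := nbr (adj G) u :\ v; set Y := nbr (adj G) v :\ u.
have vu : adj G v u by rewrite adj_sym.
have cX : 3 <= #|X| by have := cardsD1 v (nbr (adj G) u); rewrite -/X inE uv /=; lia.
have cY : b <= #|Y| by have := cardsD1 u (nbr (adj G) v); rewrite -/Y inE vu /=; lia.
have uX : u \notin X by rewrite !inE -/(adj G u u) adj_irr andbF.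
have vX : v \notin X by rewrite !inE eqxx.
have uY : u \notin Y by rewrite !inE eqxx.
have vY : v \notin Y by rewrite !inE -/(adj G v v) adj_irr andbF.
have cXY : 3 + b <= #|X :|: Y|.
  have e0 : nbr (adj G) u :|: nbr (adj G) v = u |: (v |: (X :|: Y)).
    rewrite -(nbr_closed_cover (@adj_sym _ G) uv); apply/setP => x.
    by rewrite !inE; case: eqP => // _; case: eqP => // _.
  have := (leq_card_setU [set u] (v |: (X :|: Y))).1.
  have := (leq_card_setU [set v] (X :|: Y)).1.
  by move: big; rewrite e0 !cards1; lia.
have [U [V [sU sV dUV cU cV]]] := exists_disjoint_subsets cX cY cXY.
have [f f_inj fU] := exists_inj_ord cU.
have [g g_inj gV] := exists_inj_ord cV.
have fX i := subsetP sU _ (fU i).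
have gY j := subsetP sV _ (gV j).
pose h (x : double_star_vertex 3 b) : T := match x with
  | inl None => u | inr None => v | inl (Some i) => f i | inr (Some j) => g j end.
have uv_neq : u != v by apply: contraTneq uv => ->; rewrite adj_irr.
have fg i j : f i != g j.
  apply: contraTneq (fU i) => ->; move: dUV; rewrite disjoint_sym.
  by move/disjointFr => ->.
have fu i : f i != u by apply: contraTneq (fX i) => ->.
have fv i : f i != v by apply: contraTneq (fX i) => ->.
have gu j : g j != u by apply: contraTneq (gY j) => ->.
have gv j : g j != v by apply: contraTneq (gY j) => ->.
apply/existsP; exists [ffun x => h x]; apply/andP; split.
  apply/injectiveP => x y; rewrite !ffunE.
  case: x => [[i|]|[i|]]; case: y => [[j|]|[j|]] //= /eqP;
    rewrite ?(negbTE (fg _ _)) ?(negbTE (fu _)) ?(negbTE (fv _))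
      ?(negbTE (gu _)) ?(negbTE (gv _)) ?(negbTE uv_neq) //;
    rewrite 1?eq_sym ?(negbTE (fg _ _)) ?(negbTE (fu _)) ?(negbTE (fv _))
      ?(negbTE (gu _)) ?(negbTE (gv _)) ?(negbTE uv_neq) //.
    by move/eqP/f_inj ->.
  by move/eqP/g_inj ->.
apply/'forall_forallP => x y; apply/implyP; rewrite !ffunE.
have sub2 (s t : double_star_vertex 3 b) : [set x; y] = [set s; t] -> adj G (h s) (h t) ->
    adj G (h x) (h y).
  by move=> /set2_eq[[-> ->]|[-> ->]] //; rewrite adj_sym.
rewrite /adj /= /double_star_edges !inE => /or3P[/eqP xy|/imsetP[i _ xy]|/imsetP[j _ xy]].
- exact: (sub2 _ _ xy).
- by apply: (sub2 _ _ xy); have := fX i; rewrite !inE => /andP[].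
- by apply: (sub2 _ _ xy); have := gY j; rewrite !inE => /andP[].
Qed.

Lemma edge_set_card2 (T : finType) (e : rel T) : irreflexive e ->
  [forall E in [set [set p.1; p.2] | p : T * T & e p.1 p.2], #|E| == 2].
Proof.
move=> irr; apply/forall_inP => E /imsetP[[x y]]; rewrite inE /= => xy ->.
by rewrite cards2; case: (eqVneq x y) xy => [->|] //; rewrite irr.
Qed.

Definition graph_of (T : finType) (e : rel T) (irr : irreflexive e) : graph T :=
  Graph (edge_set_card2 irr).

Lemma adj_graph_of (T : finType) (e : rel T) (irr : irreflexive e) :
  symmetric e -> adj (graph_of irr) =2 e.
Proof.
move=> sym x y; rewrite /adj /=; apply/imsetP/idP => [[[u v]]|xy]; last first.
  by exists (x, y) => //; rewrite inE.
by rewrite inE /= => uv /set2_eq[[-> ->]|[-> ->]] //; rewrite sym.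
Qed.

(** All [b + 5] vertices of a copy lie in the union of the neighbourhoods of its two centres. *)
Lemma dstar_free_is_free (T : finType) (b : nat) (G : graph T) :
  dstar_free b (adj G) -> is_free (double_star 3 b) G.
Proof.
move=> Gfree; apply/existsP => -[h /andP[/injectiveP h_inj /'forall_forallP hadj]].
pose u := h (double_star_u 3 b); pose v := h (double_star_v 3 b).
have uv : adj G u v.
  by apply: (implyP (hadj _ _)); rewrite /adj /= /double_star_edges !inE eqxx.
have uf i : adj G u (h (double_star_uleaf b i)).
  apply: (implyP (hadj _ _)); rewrite /adj /= /double_star_edges !inE.
  by apply/or3P; apply: Or32; apply/imsetP; exists i.
have vg j : adj G v (h (double_star_vleaf 3 j)).
  apply: (implyP (hadj _ _)); rewrite /adj /= /double_star_edges !inE.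
  by apply/or3P; apply: Or33; apply/imsetP; exists j.
have vu : adj G v u by rewrite adj_sym.
have cov : codom h \subset nbr (adj G) u :|: nbr (adj G) v.
  apply/subsetP => _ /codomP[x ->]; rewrite !inE.
  case: x => [[i|]|[j|]]; apply/orP.
  - by left; apply: uf.
  - by right; apply: vu.
  - by right; apply: vg.
  - by left; apply: uv.
have cu : 3 < #|nbr (adj G) u|.
  pose f (x : option 'I_3) := if x is Some i then h (double_star_uleaf b i) else v.
  have f_inj : injective f by move=> [i|] [j|] //= /h_inj // [->].
  have -> : 4 = #|codom f| by rewrite card_codom // card_option card_ord.
  apply: subset_leq_card; apply/subsetP => _ /codomP[[i|] ->]; rewrite inE.
    exact: uf.
  exact: uv.
have cv : b < #|nbr (adj G) v|.
  pose f (x : option 'I_b) := if x is Some i then h (double_star_vleaf 3 i) else u.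
  have f_inj : injective f by move=> [i|] [j|] //= /h_inj // [->].
  have -> : b.+1 = #|codom f| by rewrite card_codom // card_option card_ord.
  apply: subset_leq_card; apply/subsetP => _ /codomP[[i|] ->]; rewrite inE.
    exact: vg.
  exact: vu.
have := Gfree u v uv cu cv; have := subset_leq_card cov.
rewrite card_codom // card_sum !card_option !card_ord; lia.
Qed.

(** * Irreducible graphs *)

Section Local.
Variables (T : finType) (e : rel T) (b : nat).
Hypotheses (sym : symmetric e) (irr : irreflexive e) (hb : 3 < b).
Hypothesis free : dstar_free b e.

Local Notation N := (nbr e).

(** Summed over [A], this is twice the number of edges meeting [A]: an inner edge counts at both
    ends, a border edge twice at its end in [A]. The bound in [reducible] is thus
    [2 * 'C(b + 4, 2)]. *)
Definition cost (A : {set T}) (x : T) : nat := #|N x| + #|N x :\: A|.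

Definition reducible : Prop :=
  exists2 A : {set T}, #|A| = b + 4 &
    \sum_(x in A) cost A x <= (b + 4) * (b + 3).

Lemma card_closed_nbr v : #|v |: N v| = #|N v|.+1.
Proof. by rewrite cardsU1 inE irr. Qed.

Lemma cost_mono (A A' : {set T}) x : A \subset A' -> cost A' x <= cost A x.
Proof. by move=> sA; rewrite leq_add2l subset_leq_card // setDS. Qed.

Lemma cost_low A x : #|N x| <= 3 -> cost A x <= 6.
Proof. by move=> dx; have := subset_leq_card (subsetDl (N x) A); rewrite /cost; lia. Qed.

Lemma sum_le_const (A : {set T}) (F : T -> nat) c :
  (forall x, x \in A -> F x <= c) -> \sum_(x in A) F x <= #|A| * c.
Proof. by move=> AF; rewrite -sum_nat_const; apply: leq_sum. Qed.

Lemma pointwise_reducible (A : {set T}) : #|A| = b + 4 ->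
  (forall x, x \in A -> cost A x <= b + 3) -> reducible.
Proof. by move=> cA AF; exists A => //; rewrite -cA; apply: sum_le_const. Qed.

(* A non-low vertex adjacent to a big vertex [v] leaves [N[v]] at most
   [b + 3 - d(v)] times. *)
Lemma out_closed_nbr u v : e u v -> 3 < #|N u| -> b < #|N v| ->
  #|N u :\: (v |: N v)| + #|N v| <= b + 3.
Proof.
move=> uv du dv; have := free uv du dv.
have -> : N u :|: N v = (N u :\: (v |: N v)) :|: (v |: N v).
  apply/setP => x; rewrite !inE; case: eqP => [->|]; rewrite ?uv ?orbT //=.
  by case: (e u x); case: (e v x).
by rewrite card_setUD setDDl setUid card_closed_nbr; lia.
Qed.

Lemma closed_nbrP v x : x \in v |: N v -> x = v \/ e x v.
Proof. by case/setU1P => [|]; [left | rewrite inE sym; right]. Qed.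

Lemma out_center (v : T) (A : {set T}) : v |: N v \subset A -> #|N v :\: A| = 0.
Proof.
move=> sA; apply/eqP; rewrite cards_eq0 setD_eq0.
exact: subset_trans (subsetUr _ _) sA.
Qed.

Lemma out_mono x (A A' : {set T}) : A \subset A' -> #|N x :\: A'| <= #|N x :\: A|.
Proof. by move=> sA; rewrite subset_leq_card // setDS. Qed.

Lemma out_in_closed v u : b < #|N v| -> u \in v |: N v -> 3 < #|N u| ->
  #|N u :\: (v |: N v)| + #|N v| <= b + 3 \/ u = v.
Proof.
move=> dv /closed_nbrP[->|uv] du; [by right | left; exact: out_closed_nbr].
Qed.

Hypothesis irred : ~ reducible.

(** By [out_closed_nbr], a vertex of degree at least [b + 4] has only neighbours of degree at most
    3, and any [b + 4] of these form a reducible set. *)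
Lemma degree_le_b3 v : #|N v| <= b + 3.
Proof.
rewrite leqNgt; apply/negP => dv; apply: irred.
have [A sA cA] := @exists_subset_card _ (N v) (b + 4) ltac:(lia).
apply: (pointwise_reducible cA) => u /(subsetP sA); rewrite inE => vu.
have uv : e u v by rewrite sym.
case: (leqP #|N u| 3) => du; first by have := cost_low A du; lia.
have := out_closed_nbr uv du ltac:(lia); lia.
Qed.

(** If [v] has degree [b + 3], then [N[v]] has [b + 4] vertices, and those of degree above 3 have no
    neighbour outside it. *)
Lemma degree_le_b2 v : #|N v| <= b + 2.
Proof.
rewrite leqNgt; apply/negP => dv; apply: irred.
have dvE : #|N v| = b + 3 by have := degree_le_b3 v; lia.
have cA : #|v |: N v| = b + 4 by rewrite card_closed_nbr dvE; lia.
apply: (pointwise_reducible cA) => u uA.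
case: (leqP #|N u| 3) => du; first by have := cost_low (v |: N v) du; lia.
rewrite /cost; have := degree_le_b3 u.
case: (out_in_closed _ uA du) => [||->]; try lia.
by rewrite out_center ?subxx //; lia.
Qed.

Lemma card_setU1_notin (A : {set T}) y : y \notin A -> #|y |: A| = #|A|.+1.
Proof. by move=> yA; rewrite cardsU1 yA. Qed.

Lemma sum_setU1 (A : {set T}) y (F : T -> nat) : y \notin A ->
  \sum_(x in y |: A) F x = F y + \sum_(x in A) F x.
Proof. by move=> yA; rewrite big_setU1. Qed.

Hypothesis card_ge : b + 4 <= #|T|.

Lemma exists_notin (A : {set T}) : #|A| < b + 4 -> exists y, y \notin A.
Proof.
move=> cA; case: (set_0Vmem (~: A)) => [A0 | [y]]; last by rewrite inE; exists y.
by have := cardsC A; rewrite A0 cards0 addn0; lia.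
Qed.

(** Here [N[v]] lacks one vertex. If some [a] in it of degree above [b] has an outer neighbour [y],
    add [y]: its cost [b + 4] is balanced by the cost [b + 2] of [v]. Otherwise all of [N[v]] costs
    at most [b + 2] per vertex, which pays for an arbitrary [y]. *)
Lemma degree_le_b1 v : #|N v| <= b + 1.
Proof.
rewrite leqNgt; apply/negP => dv; apply: irred.
have dvE : #|N v| = b + 2 by have := degree_le_b2 v; lia.
set A0 := v |: N v.
have cA0 : #|A0| = b + 3 by rewrite card_closed_nbr dvE; lia.
have vA0 : v \in A0 by rewrite setU11.
have out_v : #|N v :\: A0| = 0 by rewrite out_center.
have out1 u : u \in A0 -> 3 < #|N u| -> #|N u :\: A0| <= 1.
  by move=> uA du; case: (out_in_closed _ uA du) => [||->]; rewrite -/A0 ?out_v //; lia.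
have [/existsP[a /and3P[aA da oa]] | ] :=
    boolP [exists a, [&& a \in A0, b < #|N a| & 0 < #|N a :\: A0|]].
  have [y yo] : exists y, y \in N a :\: A0 by apply/set0Pn; rewrite -card_gt0.
  have Na : N a :\: A0 = [set y].
    apply/esym/eqP; rewrite eqEcard sub1set yo cards1 out1 //; lia.
  have yA : y \notin A0 by move: yo; rewrite inE => /andP[].
  have ya : e y a by move: yo; rewrite in_setD [y \in N a]inE sym => /andP[].
  set A := y |: A0.
  have cA : #|A| = b + 4 by rewrite card_setU1_notin // cA0; lia.
  have sA : A0 \subset A by rewrite subsetUr.
  have aNA : a |: N a \subset A.
    rewrite subUset sub1set inE aA orbT /=; apply/subsetP => x xa.
    by rewrite in_setU -Na in_setD xa andbT orNb.
  exists A => //; rewrite sum_setU1 // (bigD1 v) //=.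
  have cv : cost A v = b + 2.
    by rewrite /cost out_center // dvE addn0.
  have cy : cost A y <= b + 4.
    case: (leqP #|N y| 3) => dy; first by have := cost_low A dy; lia.
    have := out_closed_nbr ya dy da; have := out_mono y aNA.
    by have := degree_le_b2 y; rewrite /cost; lia.
  have : \sum_(x in A0 :\ v) cost A x <= #|A0 :\ v| * (b + 3).
    apply: sum_le_const => u /setD1P[_ uA].
    case: (leqP #|N u| 3) => du; first by have := cost_low A du; lia.
    have := out_mono u sA; have := out1 u uA du; have := degree_le_b2 u.
    by rewrite /cost; lia.
  have -> : \sum_(x in A0 :\ v) cost A x = \sum_(x in A0 | x != v) cost A x.
    by apply: eq_bigl => x; rewrite !inE andbC.
  have := cardsD1 v A0; rewrite vA0 cA0 cv => cD.
  have -> : #|A0 :\ v| = b + 2 by lia.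
  lia.
rewrite negb_exists => /forallP noout.
have [y yA] := @exists_notin A0 ltac:(lia).
set A := y |: A0; have sA : A0 \subset A by rewrite subsetUr.
exists A; first by rewrite card_setU1_notin // cA0; lia.
rewrite sum_setU1 //.
have cy : cost A y <= (b + 2) + (b + 2).
  have := degree_le_b2 y; have := subset_leq_card (subsetDl (N y) A).
  by rewrite /cost; lia.
have : \sum_(x in A0) cost A x <= #|A0| * (b + 2).
  apply: sum_le_const => u uA; apply: leq_trans (cost_mono _ sA) _.
  case: (leqP #|N u| 3) => du; first by have := cost_low A0 du; lia.
  have := noout u; rewrite uA /= negb_and -!leqNgt /cost leqn0.
  by case/orP => [|/eqP->]; have := out1 u uA du; have := degree_le_b2 u; lia.
rewrite cA0; lia.
Qed.

Lemma degree_big u : b < #|N u| -> #|N u| = b + 1.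
Proof. by move=> du; have := degree_le_b1 u; lia. Qed.

Lemma card_big_closed u : b < #|N u| -> #|u |: N u| = b + 2.
Proof. by move=> /degree_big du; rewrite card_closed_nbr du; lia. Qed.

(** * Clusters of big vertices *)

Section Big.
Variable v : T.
Hypothesis dv : b < #|N v|.
Local Notation A0 := (v |: N v).

Lemma out_le2 u : u \in A0 -> #|N u :\: A0| <= 2.
Proof.
move=> uA; case: (leqP #|N u| 3) => du; last first.
  case: (out_in_closed dv uA du) => [|->]; first by rewrite (degree_big dv); lia.
  by rewrite out_center.
(* A vertex of degree at most 3 has [v] among its neighbours, which leaves at most two outside. *)
have /closed_nbrP[-> | uv] := uA; first by rewrite out_center.
have := cardsID A0 (N u).
suff : 0 < #|N u :&: A0| by lia.
by rewrite card_gt0; apply/set0Pn; exists v; rewrite !inE uv eqxx.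
Qed.

Lemma cost_le u : u \in A0 -> #|N u| <= b -> cost A0 u <= b + 2.
Proof. by move=> uA du; have := out_le2 uA; rewrite /cost; lia. Qed.

(* Otherwise adding to [N[v]] the outer neighbours of [a] gives a reducible set,
   since these neighbours have few edges leaving [N[a]]. *)
Lemma big_nbr_sub a : a \in A0 -> b < #|N a| -> N a \subset A0.
Proof.
(* Two outer neighbours of [a] complete [N[v]] to [b + 4] vertices; this case comes last and yields
   [out1]. With a single one, [y], an arbitrary [z] is added too; since [out1] bounds the costs in
   [N[v]] by [b + 2], even the cost [2 * (b + 1)] of [z] is affordable. *)
suff out1 : (forall u, u \in A0 -> b < #|N u| -> #|N u :\: A0| <= 1).
  move=> aA da; rewrite -setD_eq0 -cards_eq0 -leqn0 leqNgt; apply/negP => oa.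
  apply: irred.
  have [y yo] : exists y, y \in N a :\: A0 by apply/set0Pn; rewrite -card_gt0.
  have Na : N a :\: A0 = [set y].
    by apply/esym/eqP; rewrite eqEcard sub1set yo cards1 out1.
  have yA : y \notin A0 by move: yo; rewrite inE => /andP[].
  have ya : e y a by move: yo; rewrite in_setD [y \in N a]inE sym => /andP[].
  have cyA : #|y |: A0| = b + 3 by rewrite card_setU1_notin // card_big_closed //; lia.
  have [z zA] := @exists_notin (y |: A0) ltac:(lia).
  set A := z |: (y |: A0).
  have sA : y |: A0 \subset A by rewrite subsetUr.
  have sA0 : A0 \subset A by apply: subset_trans sA; rewrite subsetUr.
  exists A; first by rewrite card_setU1_notin // cyA; lia.
  have aNA : a |: N a \subset A.
    apply: subset_trans sA; rewrite subUset sub1set inE aA orbT /=.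
    by apply/subsetP => x xa; rewrite in_setU -Na in_setD xa andbT orNb.
  rewrite sum_setU1 // sum_setU1 //.
  have : \sum_(x in A0) cost A x <= #|A0| * (b + 2).
    apply: sum_le_const => u uA; apply: leq_trans (cost_mono _ sA0) _.
    case: (leqP #|N u| b) => du; first exact: cost_le.
    by have := out1 u uA du; have := degree_le_b1 u; rewrite /cost; lia.
  have cy : cost A y <= b + 3.
    case: (leqP #|N y| 3) => dy; first by have := cost_low A dy; lia.
    have := out_closed_nbr ya dy da; have := out_mono y aNA.
    by have := degree_le_b1 y; rewrite /cost; lia.
  have cz : cost A z <= (b + 1) + (b + 1).
    have := degree_le_b1 z; have := subset_leq_card (subsetDl (N z) A).
    by rewrite /cost; lia.
  rewrite card_big_closed //; lia.
move=> {}a aA da; rewrite leqNgt; apply/negP => oa; apply: irred.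
set A := (N a :\: A0) :|: A0.
have o2 : #|N a :\: A0| = 2 by have := out_le2 aA; lia.
have cA : #|A| = b + 4.
  by rewrite /A card_setUD setDDl setUid o2 card_big_closed //; lia.
have sA0 : A0 \subset A by rewrite subsetUr.
have aNA : a |: N a \subset A.
  rewrite subUset sub1set inE aA orbT /=.
  by apply/subsetP => x xa; rewrite inE in_setD xa andbT orNb.
apply: (pointwise_reducible cA) => u.
case: (leqP #|N u| 3) => du; first by have := cost_low A du; lia.
rewrite /cost; case/setUP => [|uA]; last first.
  by have := out_le2 uA; have := out_mono u sA0; have := degree_le_b1 u; lia.
rewrite in_setD [u \in N a]inE sym => /andP[_ ua].
have := out_closed_nbr ua du da; have := out_mono u aNA.
have := degree_le_b1 u; lia.
Qed.

Lemma cost_big u : u \in A0 -> b < #|N u| -> cost A0 u = b + 1.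
Proof.
move=> uA du; rewrite /cost degree_big //.
by have /eqP-> : N u :\: A0 == set0; rewrite ?setD_eq0 ?big_nbr_sub ?cards0 ?addn0.
Qed.

Lemma cost_le_b2 u : u \in A0 -> cost A0 u <= b + 2.
Proof.
move=> uA; case: (leqP #|N u| b) => du; first exact: cost_le.
by rewrite cost_big //; lia.
Qed.

(** Add [y] and an arbitrary [z] to [N[v]]. Every edge from [y] to [N[v]] lowers the cost by one at
    each of its ends, and [v] costs one less than the bound [b + 2]. A larger overlap would make the
    set reducible. *)
Lemma overlap_bound y : y \notin A0 -> b < #|N y| ->
  2 * #|N y :&: A0| + 6 <= b.
Proof.
move=> yA dy; rewrite leqNgt; apply/negP => ov; apply: irred.
have cyA : #|y |: A0| = b + 3 by rewrite card_setU1_notin // card_big_closed //; lia.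
have [z zA] := @exists_notin (y |: A0) ltac:(lia).
set A := z |: (y |: A0).
have sA : y |: A0 \subset A by rewrite subsetUr.
have sA0 : A0 \subset A by apply: subset_trans sA; rewrite subsetUr.
exists A; first by rewrite card_setU1_notin // cyA; lia.
rewrite sum_setU1 // sum_setU1 //.
have cz : cost A z <= (b + 1) + (b + 1).
  have := degree_le_b1 z; have := subset_leq_card (subsetDl (N z) A).
  by rewrite /cost; lia.
have cy : cost A y + #|N y :&: A0| <= (b + 1) + (b + 1).
  have := cardsID A0 (N y); have := out_mono y sA0; have := degree_le_b1 y.
  by rewrite /cost; lia.
have vA : v \in A0 by rewrite setU11.
have sN : N y :&: A0 \subset A0 :\ v.
  rewrite subsetD1 subsetIr /= !inE eqxx andbT /= sym.
  by apply/negP => vy; move: yA; rewrite !inE vy orbT.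
have : \sum_(x in A0) (cost A x + ((x \in N y) || (x == v))) <= #|A0| * (b + 2).
  apply: sum_le_const => u uA.
  case uy: (u \in N y) => /=; last first.
    case: eqP => [-> | _].
      by rewrite /cost out_center // degree_big //; lia.
    by have := cost_mono u sA0; have := cost_le_b2 uA; lia.
  have yu : y \in N u :\: A0 by rewrite in_setD yA; rewrite !inE sym in uy *.
  have := cost_le_b2 uA; rewrite /cost.
  have : #|N u :\: A| < #|N u :\: A0|.
    apply: proper_card; apply/properP; split; first exact: setDS.
    by exists y => //; rewrite !inE eqxx orbT.
  lia.
rewrite big_split /= card_big_closed //.
have : \sum_(x in A0) ((x \in N y) || (x == v) : nat) = #|N y :&: A0|.+1.
  rewrite (bigD1 v) //= eqxx orbT add1n; congr _.+1.
  rewrite -sum1_card [RHS]big_mkcond [LHS]big_mkcond; apply: eq_bigr => x _.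
  case: (eqVneq x v) => [->|xv]; rewrite ?andbF ?andbT.
    by case: ifP => // /(subsetP sN); rewrite setD11.
  by rewrite in_setI orbF; case: (x \in A0); case: (x \in N y).
lia.
Qed.

(* A non-low vertex in [N(v) :&: N(y)] has at most two neighbours outside each
   of [N[v]] and [N[y]], hence nearly all of them in the small set [N(v) :&: N(y)]. *)
Lemma overlap_degree y u : y \notin A0 -> b < #|N y| -> u \in N y :&: A0 ->
  2 * #|N u| <= b.
Proof.
move=> yA dy /setIP[uy uA]; have ov := overlap_bound yA dy.
rewrite inE sym in uy.
have uv : e u v.
  have /closed_nbrP[uv|//] := uA; move: yA; rewrite -uv !inE.
  by rewrite uy orbT.
case: (leqP #|N u| 3) => du; first lia.
have := out_closed_nbr uv du dv; have := out_closed_nbr uy du dy.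
rewrite (degree_big dv) (degree_big dy) => oy ov'.
have : N u \subset (N u :\: A0) :|: (N u :\: (y |: N y)) :|: ((N y :&: A0) :\ u).
  apply/subsetP => x ux; rewrite !in_setU !in_setD ux in_set1 in_setI !andbT.
  have -> : x != u by apply: contraTneq ux => ->; rewrite inE irr.
  case xA: (x \in A0) => //=; rewrite !inE.
  case: (eqVneq x y) => [xy | _] /=; last by case: (e y x).
  by rewrite xy (negbTE yA) in xA.
move/subset_leq_card.
have := (leq_card_setU ((N u :\: A0) :|: (N u :\: (y |: N y))) ((N y :&: A0) :\ u)).1.
have := (leq_card_setU (N u :\: A0) (N u :\: (y |: N y))).1.
have := cardsD1 u (N y :&: A0); rewrite in_setI uA inE sym uy /=.
lia.
Qed.

End Big.

(** * Degree sums of irreducible graphs *)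

Lemma sum_degree_split (A : {set T}) :
  \sum_x #|N x| = \sum_(x in A) cost A x + \sum_(x in ~: A) #|N x :\: A|.
Proof.
rewrite (bigID (mem A)) /= big_split /= -addnA; congr (_ + _).
have -> : \sum_(x | x \notin A) #|N x| =
    \sum_(x in ~: A) #|N x :&: A| + \sum_(x in ~: A) #|N x :\: A|.
  rewrite -big_split; apply: eq_big => [x | x _]; first by rewrite inE.
  by rewrite /= cardsID.
(* Both sides count the border edges of [A], one from outside and the other from inside. *)
congr (_ + _).
have cardE (B C : {set T}) x : x \in C -> #|N x :&: B| = \sum_(y in B) (e x y : nat).
  move=> _; rewrite -sum1_card [RHS]big_mkcond [LHS]big_mkcond; apply: eq_bigr => y _.
  by rewrite !inE; case: (e x y); case: (y \in B).
rewrite (eq_bigr _ (cardE A (~: A))) exchange_big /=; apply: eq_bigr => x xA.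
rewrite setDE (cardE _ A) //; apply: eq_bigr => y _.
by rewrite sym.
Qed.

Lemma sum_setT (F : T -> nat) : \sum_(x in [set: T]) F x = \sum_x F x.
Proof. by apply: eq_bigl => x; rewrite inE. Qed.

Lemma sum_degree_le : \sum_x #|N x| <= (b + 1) * #|T|.
Proof.
rewrite mulnC -cardsT.
by rewrite -sum_setT; apply: sum_le_const => x _; apply: degree_le_b1.
Qed.

Lemma card_indicator (A B : {set T}) : \sum_(x in A) (x \in B : nat) = #|B :&: A|.
Proof.
rewrite -sum1_card [RHS]big_mkcond [LHS]big_mkcond; apply: eq_bigr => x _.
by rewrite inE; case: (x \in A); case: (x \in B).
Qed.

Local Notation bigs := [set u | b < #|N u|].

(** Only [q + 2] vertices lie outside [N[v]], so each has at most [q + 1] neighbours there. *)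
Lemma out_sum_le v q : b < #|N v| -> #|T| = b + 4 + q ->
  \sum_(x in ~: (v |: N v)) #|N x :\: (v |: N v)| <= (q + 2) * (q + 1).
Proof.
move=> dv cT; set A := v |: N v.
have cA : #|~: A| = q + 2 by have := cardsC A; rewrite card_big_closed //; lia.
rewrite -cA; apply: sum_le_const => x xA.
have : N x :\: A \subset (~: A) :\ x.
  apply/subsetP => y; rewrite in_setD => /andP[yA xy].
  rewrite in_setD1 inE yA andbT; apply: contraTneq xy => ->.
  by rewrite inE irr.
by move/subset_leq_card; have := cardsD1 x (~: A); rewrite xA cA; lia.
Qed.

Lemma sum_degree_cluster v q : b < #|N v| -> #|T| = b + 4 + q ->
  \sum_x #|N x| + #|bigs :&: (v |: N v)| <= (b + 2) * (b + 2) + (q + 2) * (q + 1).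
Proof.
move=> dv cT; rewrite (sum_degree_split (v |: N v)).
have := out_sum_le dv cT.
have : \sum_(x in v |: N v) (cost (v |: N v) x + (x \in bigs)) <= #|v |: N v| * (b + 2).
  apply: sum_le_const => u uA; rewrite inE.
  by case: leqP => du; [rewrite addn0 cost_le | rewrite cost_big //; lia].
rewrite big_split /= card_indicator card_big_closed //; lia.
Qed.

(** A vertex of the overlap costs at most [b / 2 + 2] instead of [b + 2]; everything is doubled to
    avoid the fraction. *)
Lemma sum_degree_two_clusters v q y : b < #|N v| -> #|T| = b + 4 + q ->
  y \notin v |: N v -> b < #|N y| ->
  2 * \sum_x #|N x| + 2 * #|bigs :&: (v |: N v)| + b * #|N y :&: (v |: N v)|
    <= 2 * ((b + 2) * (b + 2)) + 2 * ((q + 2) * (q + 1)).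
Proof.
move=> dv cT yA dy.
have := out_sum_le dv cT.
have : \sum_(x in v |: N v)
    (cost (v |: N v) x * 2 + (x \in bigs) * 2 + (x \in N y) * b) <=
    #|v |: N v| * (2 * (b + 2)).
  apply: sum_le_const => u uA; rewrite inE.
  case uy: (u \in N y).
    have du : 2 * #|N u| <= b by apply: (overlap_degree dv yA dy); rewrite in_setI uy.
    rewrite ltnNge (_ : #|N u| <= b); last by lia.
    by have := out_le2 dv uA; rewrite /cost; lia.
  by case: leqP => du; [have := cost_le dv uA du | rewrite cost_big //]; lia.
rewrite !big_split /= -!big_distrl /= !card_indicator card_big_closed //.
rewrite (sum_degree_split (v |: N v)); lia.
Qed.

Lemma sum_degree_one_cluster v : b < #|N v| -> bigs \subset v |: N v ->
  \sum_x #|N x| <= b * #|T| + #|bigs :&: (v |: N v)|.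
Proof.
move=> dv /setIidPl->.
have : \sum_(x in [set: T]) #|N x| <= \sum_(x in [set: T]) (b + (x \in bigs)).
  by apply: leq_sum => x _; rewrite inE; have := degree_le_b1 x; case: leqP => /=; lia.
by rewrite big_split /= card_indicator setIT sum_nat_const cardsT mulnC sum_setT.
Qed.

(** Relative to degree [b], only the big vertices of [N[v]] and the [q + 2] vertices outside can
    gain one, while those of the overlap lose [b / 2]. *)
Lemma sum_degree_two_clusters_big v q y : b < #|N v| -> #|T| = b + 4 + q ->
  y \notin v |: N v -> b < #|N y| ->
  2 * \sum_x #|N x| + b * #|N y :&: (v |: N v)|
    <= 2 * (b * #|T|) + 2 * #|bigs :&: (v |: N v)| + 2 * (q + 2).
Proof.
move=> dv cT yA dy; set A := v |: N v.
have cA : #|~: A| = q + 2 by have := cardsC A; rewrite card_big_closed //; lia.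
have : \sum_(x in [set: T]) (#|N x| * 2 + (x \in N y :&: A) * b) <=
    \sum_(x in [set: T]) (b * 2 + (x \in bigs :&: A) * 2 + (x \in ~: A) * 2).
  apply: leq_sum => u _.
  case uy: (u \in N y :&: A).
    by have := overlap_degree dv yA dy uy; lia.
  rewrite in_setI in_setC [u \in bigs]inE.
  by have := degree_le_b1 u; case: (u \in A); case: leqP => /=; lia.
rewrite !big_split /= -!big_distrl /= !card_indicator !setIT cA sum_nat_const cardsT.
rewrite sum_setT; move: (\sum_x #|N x|) #|N y :&: A| #|T| #|_ :&: A|; lia.
Qed.

Lemma overlap_ge v q y : b < #|N v| -> #|T| = b + 4 + q ->
  y \notin v |: N v -> b < #|N y| -> b <= q + #|N y :&: (v |: N v)|.
Proof.
move=> dv cT yA dy; set A := v |: N v.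
have cA : #|~: A| = q + 2 by have := cardsC A; rewrite card_big_closed //; lia.
have : N y :\: A \subset (~: A) :\ y.
  apply/subsetP => x; rewrite in_setD => /andP[xA xy].
  rewrite in_setD1 inE xA andbT; apply: contraTneq xy => ->.
  by rewrite inE irr.
move/subset_leq_card; have := cardsD1 y (~: A); rewrite inE yA cA.
have := cardsID A (N y); rewrite (degree_big dy) /=; lia.
Qed.

End Local.

(** * The extremal value *)

Lemma double_bin2 n : 2 * 'C(n, 2) + n = n * n.
Proof. by elim: n => // n IH; rewrite binS bin1; lia. Qed.

Definition dstar_value (b p q : nat) : nat :=
  if [|| (24 <= b) && (4 <= q <= b - 4),
         (16 <= b <= 23) && (5 <= q <= b - 4)
       | (14 <= b <= 15) && (6 <= q <= b - 5)]
  then (p - 1) * 'C(b + 4, 2) + (b * (b + 4 + q)) %/ 2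
  else if (22 <= b) && (q == b - 3)
  then (p - 1) * 'C(b + 4, 2) + (b * (2 * b + 1) + 3) %/ 2
  else if (34 <= b) && (q == b - 2)
  then (p - 1) * 'C(b + 4, 2) + (b * (2 * b + 2) + 2 + b %/ 2) %/ 2
  else p * 'C(b + 4, 2) + 'C(q, 2).

Lemma dstar_value_S b p q : dstar_value b p.+2 q = 'C(b + 4, 2) + dstar_value b p.+1 q.
Proof. by rewrite /dstar_value !subn1 /= mulSn; do ![case: ifP => _]; rewrite addnA. Qed.

(** This reduces all comparisons to [p = 1]. The value [p = 0] is excluded because [p - 1] is
    truncated there. *)
Lemma dstar_value_eq b p q : 0 < p ->
  dstar_value b p q = p.-1 * 'C(b + 4, 2) + dstar_value b 1 q.
Proof. by case: p => // p _; elim: p => // p IH; rewrite dstar_value_S IH mulSn addnA. Qed.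

Lemma clique_le_value b q : 3 < b -> q <= b + 3 ->
  'C(b + 4, 2) + 'C(q, 2) <= dstar_value b 1 q.
Proof.
move=> hb hq; rewrite /dstar_value subnn mul0n add0n mul1n.
have := double_bin2 (b + 4); have := double_bin2 q.
move: 'C(q, 2) 'C(b + 4, 2) => x y hx hy.
case: ifP => [h|_].
  rewrite leq_divRL //.
  (* This compares [2 * ('C(b + 4, 2) + 'C(q, 2))] with [b * (b + 4 + q)], up to one unit. Below,
     [c] and [d] are the slacks in the lower and upper constraint on [q]. *)
  suff : q * q + 12 + 3 * b <= b * q + q + 1 by nia.
  case/or3P: h => /andP[h1 /andP[h2 h3]].
  - have [c cE] : exists c, q = 4 + c by exists (q - 4); lia.
    have [d dE] : exists d, b = 8 + c + d by exists (b - 8 - c); lia.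
    subst; nia.
  - have [c cE] : exists c, q = 5 + c by exists (q - 5); lia.
    have [d dE] : exists d, b = 9 + c + d by exists (b - 9 - c); lia.
    subst; nia.
  - have [c cE] : exists c, q = 6 + c by exists (q - 6); lia.
    have [d dE] : exists d, b = 11 + c + d by exists (b - 11 - c); lia.
    subst; nia.
case: ifP => [/andP[h1 /eqP h2]|_].
  have bE : b = q + 3 by lia.
  by rewrite leq_divRL //; clear h2; subst b; nia.
case: ifP => [/andP[h1 /eqP h2]|_] //.
have bE : b = q + 2 by lia.
by rewrite leq_divRL //; clear h2; subst b; nia.
Qed.

(** Outside the first two cases, a [b]-regular graph has no more edges than disjoint cliques; the
    last [+ 1] is absorbed by rounding. For [b >= 24] only the two ends of the range of [q] remain,
    and smaller [b] are checked by computation. *)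
Lemma regular_vs_clique b q : 3 < b -> q <= b + 3 ->
  ~~ [|| (24 <= b) && (4 <= q <= b - 4),
         (16 <= b <= 23) && (5 <= q <= b - 4)
       | (14 <= b <= 15) && (6 <= q <= b - 5)] ->
  ~~ ((22 <= b) && (q == b - 3)) ->
  b * q + q <= q * q + 12 + 3 * b + 1.
Proof.
move=> hb hq h h'.
case: (leqP 24 b) => b24.
  have [q3|[c cE]] : q <= 3 \/ exists c, q = b - 2 + c.
    by case: (leqP (b - 2) q) => h2; [right; exists (q - (b - 2)) |left]; lia.
    by case: q q3 {hq h h'} => [|[|[|[|]]]] //; lia.
  have [d dE] : exists d, b = d + 2 by exists (b - 2); lia.
  by rewrite dE addnK in cE; clear h h'; subst q b; nia.
have /allP/(_ b) : all (fun b => all (fun q =>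
    ~~ [|| (24 <= b) && (4 <= q <= b - 4),
         (16 <= b <= 23) && (5 <= q <= b - 4)
       | (14 <= b <= 15) && (6 <= q <= b - 5)] ==>
    ~~ ((22 <= b) && (q == b - 3)) ==>
    (b * q + q <= q * q + 12 + 3 * b + 1)) (iota 0 27)) (iota 0 24) by vm_compute.
rewrite mem_iota b24 => /(_ isT)/allP/(_ q).
rewrite mem_iota => /(_ ltac:(lia)) /implyP/(_ h)/implyP; exact.
Qed.

Lemma regular_le_value b q : 3 < b -> q <= b + 3 ->
  (b * (b + 4 + q)) %/ 2 <= dstar_value b 1 q.
Proof.
move=> hb hq; rewrite /dstar_value subnn mul0n add0n mul1n.
have := double_bin2 (b + 4); have := double_bin2 q.
move: 'C(q, 2) 'C(b + 4, 2) => x y hx hy.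
case: ifP => [//|/negbT h].
case: ifP => [/andP[h1 /eqP h2]|/negbT h'].
  have bE : b = q + 3 by lia.
  by apply: leq_div2r; clear h2; subst b; nia.
case: ifP => [/andP[h1 /eqP h2]|/negbT h''].
  have bE : b = q + 2 by lia.
  by apply: leq_div2r; clear h2; subst b; nia.
have := regular_vs_clique hb hq h h'; nia.
Qed.

(** Below the threshold [22] disjoint cliques are at least as good, so the upper bound need not
    distinguish the two ranges of [b]. The same holds for [q2_le_value] with [34]. *)
Lemma q3_le_value b : 3 < b ->
  (b * (2 * b + 1) + 3) %/ 2 <= dstar_value b 1 (b - 3).
Proof.
move=> hb; case: (leqP 22 b) => h.
  rewrite /dstar_value subnn mul0n add0n.
  by rewrite h eqxx ifF; last by lia.
apply: leq_trans (clique_le_value hb _); last by lia.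
have := double_bin2 (b + 4); have := double_bin2 (b - 3).
move: 'C(b - 3, 2) 'C(b + 4, 2) => x y hx hy.
have [q bE] : exists q, b = q + 3 by exists (b - 3); lia.
move: hx hy; rewrite bE addnK => hx hy; nia.
Qed.

Lemma q2_le_value b : 3 < b ->
  (b * (2 * b + 2) + 2 + b %/ 2) %/ 2 <= dstar_value b 1 (b - 2).
Proof.
move=> hb; case: (leqP 34 b) => h.
  rewrite /dstar_value subnn mul0n add0n.
  by rewrite h eqxx !ifF //; lia.
apply: leq_trans (clique_le_value hb _); last by lia.
have := double_bin2 (b + 4); have := double_bin2 (b - 2).
move: 'C(b - 2, 2) 'C(b + 4, 2) => x y hx hy.
have [q bE] : exists q, b = q + 2 by exists (b - 2); lia.
move: hx hy; rewrite bE addnK => hx hy; nia.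
Qed.

(** * Upper bound *)

Lemma half_le_clique b q D : 3 < b -> q <= b + 3 ->
  D + q <= (b + 4) * (b + 3) + q * q -> D %/ 2 <= dstar_value b 1 q.
Proof.
move=> hb hq hD; apply: leq_trans (clique_le_value hb hq).
have := double_bin2 (b + 4); have := double_bin2 q; nia.
Qed.

Lemma half_le_regular b q D : 3 < b -> q <= b + 3 ->
  D <= b * (b + 4 + q) -> D %/ 2 <= dstar_value b 1 q.
Proof.
by move=> hb hq hD; apply: leq_trans (regular_le_value hb hq); apply: leq_div2r.
Qed.

(** For [q <= b - 4] the first bound suffices. For [q = b - 3] and [q = b - 2], adding both bounds
    eliminates [k] and yields the terms [3] and [2 + b %/ 2]. For [q = b - 1], [k <= b + 2] is
    enough in the second bound. *)
Lemma one_cluster_value b q k D : 3 < b -> q < b -> 0 < k -> k <= b + 2 ->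
  D + k <= (b + 2) * (b + 2) + (q + 2) * (q + 1) ->
  D <= b * (b + 4 + q) + k ->
  D %/ 2 <= dstar_value b 1 q.
Proof.
move=> hb qb k0 kb D1 D2.
have hq : q <= b + 3 by lia.
have [qb4 | [bE | [bE | bE]]] : q + 4 <= b \/ b = q + 3 \/ b = q + 2 \/ b = q + 1.
  by lia.
- case: (leqP 9 b) => b9; last by apply: half_le_clique => //; nia.
  case: q => [|q] in qb4 D1 D2 hq qb *; first by apply: half_le_clique => //; nia.
  apply: half_le_regular => //.
  have [d dE] : exists d, b = q + 5 + d by exists (b - (q + 5)); lia.
  by clear qb4 hq qb; subst b; nia.
- apply: leq_trans (_ : _ <= (b * (2 * b + 1) + 3) %/ 2) _.
    by apply: leq_div2r; clear hb qb hq kb k0; subst b; nia.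
  by have := q3_le_value hb; rewrite [in dstar_value _ _ _]bE addnK -bE.
- apply: leq_trans (_ : _ <= (b * (2 * b + 2) + 2 + b %/ 2) %/ 2) _.
    have : 2 * (b %/ 2) + 1 >= b by lia.
    move: (b %/ 2) => h hh.
    by apply: leq_div2r; clear hb qb hq kb k0; subst b; nia.
  by have := q2_le_value hb; rewrite [in dstar_value _ _ _]bE addnK -bE.
- by apply: half_le_clique => //; subst b; nia.
Qed.

(** For [q = b - 3], [b - 2], [b - 1] the overlap [s] is at least 3, 2, 1, and the loss [b * s]
    brings the sum down to the regular or the clique value. Only for [q = b - 1] must two bounds be
    added to eliminate [k]. *)
Lemma two_clusters_value b q k s D : 3 < b -> q < b -> 0 < k ->
  b <= q + s -> 2 * s + 6 <= b ->
  D + k <= (b + 2) * (b + 2) + (q + 2) * (q + 1) ->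
  2 * D + 2 * k + b * s <= 2 * ((b + 2) * (b + 2)) + 2 * ((q + 2) * (q + 1)) ->
  2 * D + b * s <= 2 * (b * (b + 4 + q)) + 2 * k + 2 * (q + 2) ->
  D %/ 2 <= dstar_value b 1 q.
Proof.
move=> hb qb k0 bs sb D0 D1 D2.
have hq : q <= b + 3 by lia.
have s1 : 0 < s by lia.
have bs1 : b <= b * s by rewrite leq_pmulr.
have [qb4 | [bE | [bE | bE]]] : q + 4 <= b \/ b = q + 3 \/ b = q + 2 \/ b = q + 1.
  by lia.
- case: (leqP 9 b) => b9; last by apply: half_le_clique => //; nia.
  case: q => [|q] in qb4 D0 D1 D2 hq qb bs *; first by apply: half_le_clique => //; nia.
  apply: half_le_regular => //.
  have [d dE] : exists d, b = q + 5 + d by exists (b - (q + 5)); lia.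
  by clear qb4 hq qb bs sb bs1 D1 D2; subst b; nia.
- apply: half_le_regular => //.
  by clear hb qb hq D2 D0; subst b; nia.
- apply: half_le_clique => //.
  have bs2 : b * 2 <= b * s by rewrite leq_mul2l; lia.
  by clear hb qb hq D2 D0; subst b; nia.
- apply: half_le_clique => //.
  by clear hb qb hq D0; subst b; nia.
Qed.

(** * From irreducible graphs to all graphs *)

Section Upper.
Variables (T : finType) (e : rel T) (b : nat).
Hypotheses (sym : symmetric e) (irr : irreflexive e) (hb : 3 < b).
Hypothesis free : dstar_free b e.

Lemma irreducible_value q : ~ reducible e b -> #|T| = b + 4 + q -> q <= b + 3 ->
  (\sum_x #|nbr e x|) %/ 2 <= dstar_value b 1 q.
Proof.
move=> irred cT hq.
have card_ge : b + 4 <= #|T| by lia.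
case: (leqP b q) => qb.
  apply: half_le_clique => //.
  have := sum_degree_le sym irr hb free irred card_ge; rewrite cT.
  by move: (\sum_x _) => D hD; nia.
case: (pickP [pred v | b < #|nbr e v|]) => [v /= dv | nobig]; last first.
  apply: half_le_regular => //; rewrite -cT mulnC -sum_nat_const.
  by apply: leq_sum => x _; have := nobig x; rewrite /= ltnNge => /negbFE.
set A := v |: nbr e v; set k := #|[set u | b < #|nbr e u|] :&: A|.
have k0 : 0 < k.
  by rewrite card_gt0; apply/set0Pn; exists v; rewrite !inE dv eqxx.
have kb : k <= b + 2.
  by rewrite -(card_big_closed sym irr hb free irred card_ge dv) subset_leq_card ?subsetIr.
have I1 := sum_degree_cluster sym irr hb free irred card_ge dv cT.
have [sA | /subsetPn[y]] := boolP ([set u | b < #|nbr e u|] \subset A).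
  have I2 := sum_degree_one_cluster sym irr hb free irred card_ge dv sA.
  by rewrite cT in I2; apply: (one_cluster_value hb qb k0 kb I1 I2).
rewrite inE => dy yA.
have I2 := sum_degree_two_clusters sym irr hb free irred card_ge dv cT yA dy.
have I3 := sum_degree_two_clusters_big sym irr hb free irred card_ge dv cT yA dy.
rewrite [in b * #|T|]cT in I3.
have ov := overlap_bound sym irr hb free irred card_ge dv yA dy.
have og := overlap_ge sym irr hb free irred card_ge dv cT yA dy.
exact: (two_clusters_value hb qb k0 og ov I1 I2 I3).
Qed.

(** Each of the [p.+1] blocks of [b + 4] vertices falls short of a clique by [2 * (b + 4)] in degree
    sum. This covers the excess of one per vertex over degree [b] in the last [b + 4 + q] vertices,
    as [q <= b + 3]. *)
Lemma irreducible_value_large p q : ~ reducible e b ->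
  #|T| = p.+2 * (b + 4) + q -> q <= b + 3 ->
  (\sum_x #|nbr e x|) %/ 2 <= dstar_value b p.+2 q.
Proof.
move=> irred cT hq.
have card_ge : b + 4 <= #|T| by lia.
rewrite dstar_value_eq //=.
apply: leq_trans (_ : _ <= p.+1 * 'C(b + 4, 2) + (b * (b + 4 + q)) %/ 2) _; last first.
  by rewrite leq_add2l regular_le_value.
have := sum_degree_le sym irr hb free irred card_ge; rewrite cT.
move: (\sum_x _) => D hD.
have : D <= p.+1 * 'C(b + 4, 2) * 2 + b * (b + 4 + q).
  have := double_bin2 (b + 4); nia.
lia.
Qed.

Lemma sum_degree_delete (A : {set T}) :
  let e' := fun x y : {x | x \in ~: A} => e (val x) (val y) in
  \sum_x #|nbr e x| = \sum_(x in A) cost e A x + \sum_x #|nbr e' x| /\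
  dstar_free b e'.
Proof.
move=> e'.
have imE x : [set val y | y in nbr e' x] = nbr e (val x) :\: A.
  apply/setP => y; rewrite in_setD inE; apply/imsetP/andP => [[z]|[yA xy]].
    by rewrite inE => xz ->; split=> //; have := valP z; rewrite inE.
  have yA' : y \in ~: A by rewrite inE.
  by exists (Sub y yA') => //; rewrite inE /e' /= ?SubK.
have cardE x : #|nbr e' x| = #|nbr e (val x) :\: A|.
  by rewrite -imE card_imset //; apply: val_inj.
split.
  rewrite (sum_degree_split sym A); congr (_ + _).
  rewrite [LHS]big_sub; apply: eq_bigr => x _; exact/esym.
move=> u v uv du dv.
have le x : #|nbr e' x| <= #|nbr e (val x)|.
  by rewrite cardE subset_leq_card ?subsetDl.
have := free uv (leq_trans du (le u)) (leq_trans dv (le v)).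
apply: leq_trans; rewrite -(card_imset _ val_inj) imsetU !imE -setDUl.
by rewrite subset_leq_card ?subsetDl.
Qed.

Lemma reducible_delete : reducible e b ->
  exists (T' : finType) (e' : rel T'), [/\ symmetric e', irreflexive e',
    dstar_free b e', #|T'| + (b + 4) = #|T| &
    \sum_x #|nbr e x| <= (b + 4) * (b + 3) + \sum_x #|nbr e' x|].
Proof.
move=> [A cA sA]; have [-> free'] := sum_degree_delete A.
exists {x | x \in ~: A}, (fun x y => e (val x) (val y)); split => //.
- by rewrite card_sig -(cardsC A) cA addnC; congr addn; apply: eq_card => x.
- by rewrite leq_add2r.
Qed.

Lemma reducible_dec : reducible e b \/ ~ reducible e b.
Proof.
have [/existsP[A /andP[/eqP cA sA]] | /existsPn noA] :=
  boolP [exists A : {set T}, (#|A| == b + 4) &&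
    (\sum_(x in A) cost e A x <= (b + 4) * (b + 3))]; first by left; exists A.
by right=> -[A cA sA]; have := noA A; rewrite cA eqxx sA.
Qed.

End Upper.

Lemma sum_degree_le_complete (T : finType) (e : rel T) : irreflexive e ->
  \sum_x #|nbr e x| + #|T| <= #|T| * #|T|.
Proof.
move=> irr; rewrite -[X in _ + X]muln1 -sum_nat_const -big_split /= -sum_nat_const.
apply: leq_sum => x _; rewrite addn1 -cardsT (cardsD1 x [set: T]) in_setT add1n ltnS.
apply/subset_leq_card/subsetP => y; rewrite !inE andbT.
by apply: contraTneq => ->; rewrite irr.
Qed.

Lemma half_sum_degree_le_value p (T : finType) (e : rel T) b q :
  symmetric e -> irreflexive e -> 3 < b -> dstar_free b e ->
  #|T| = p.+1 * (b + 4) + q -> q <= b + 3 ->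
  (\sum_x #|nbr e x|) %/ 2 <= dstar_value b p.+1 q.
Proof.
move=> sym irr hb free cT hq; have cC := double_bin2 (b + 4).
elim: p T e sym irr free cT => [|p IH] T e sym irr free cT;
  case: (reducible_dec e b) => [/(reducible_delete sym irr free)
    [T' [e' [sym' irr' free' cT' le]]] | irred].
(* After the deletion [q] vertices are left, with degree sum at most [q * (q - 1)]. *)
- apply: half_le_clique => //.
  by have := sum_degree_le_complete irr'; rewrite (_ : #|T'| = q); last lia; lia.
- by apply: irreducible_value => //; lia.
- rewrite dstar_value_S.
  have := IH _ _ sym' irr' free' ltac:(lia).
  by move: (\sum_x _) (\sum_x _) le => D D'; lia.
- exact: irreducible_value_large.
Qed.

(** * Lower bound *)

Lemma card_add_mod_lt (m r : nat) (i : 'I_m) : r <= m ->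
  #|[set j : 'I_m | (i + j) %% m < r]| = r.
Proof.
move=> rm; have m0 : 0 < m by case: i => i /=; lia.
pose f (j : 'I_m) := Ordinal (ltn_pmod (i + j) m0).
have f_inj : injective f.
  move=> j j' /(congr1 val)/eqP; rewrite /= eqn_modDl !modn_small // => /eqP.
  exact: val_inj.
have -> : [set j : 'I_m | (i + j) %% m < r] = f @^-1: [set k : 'I_m | k < r].
  by apply/setP => j; rewrite !inE.
rewrite card_preimset // -sum1dep_card big_ord_narrow // sum_nat_const card_ord.
by rewrite muln1.
Qed.

Lemma double_mod_small (m i : nat) : i < m ->
  (i + i) %% m = if i + i < m then i + i else i + i - m.
Proof.
move=> im; case: ltnP => h; first by rewrite modn_small.
by rewrite -{1}(subnK h) modnDr modn_small //; lia.
Qed.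

(** * Nearly regular graphs *)

Section NearRegular.
Variables m r : nat.
Hypothesis rm : r < m.

(** The [i] with [2 i mod m < r] form two intervals, starting at [0] and [(m + 1) %/ 2]; reversing
    one onto the other gives pairs of constant sum [s]. If [m] and [r] are odd, the second is
    shorter by one, so [s] drops by one and [(r - 1) %/ 2] stays unmatched. *)
Let s := (m + 1) %/ 2 + (r - 1) %/ 2 - minn (m %% 2) (r %% 2).

(* The sum graph [(i + j) mod m < r] has degree [r], except that it misses a
   loop at the [i] with [2 i mod m < r]; these vertices are matched with each
   other, all but at most one of them, by the pairs of sum [s]. *)
Definition near_regular : rel 'I_m := fun i j =>
  (i != j) && (((i + j) %% m < r) ||
    [&& i + j == s :> nat, (i + i) %% m < r & (j + j) %% m < r]).

Lemma near_regular_sym : symmetric near_regular.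
Proof.
move=> i j; rewrite /near_regular eq_sym addnC; congr (_ && (_ || _)).
by congr (_ && _); rewrite andbC.
Qed.

Lemma near_regular_irr : irreflexive near_regular.
Proof. by move=> i; rewrite /near_regular eqxx. Qed.

Let S (i : 'I_m) := [set j : 'I_m | (i + j) %% m < r].

Lemma near_regular_degree_le i : #|nbr near_regular i| <= r.
Proof.
have cS : #|S i| = r by rewrite card_add_mod_lt // ltnW.
case: (ltnP ((i + i) %% m) r) => di; last first.
  rewrite -cS; apply/subset_leq_card/subsetP => j; rewrite !inE => /andP[_].
  by rewrite [_ < r in X in _ || X]ltnNge di andbF orbF.
have : nbr near_regular i \subset (S i :\ i) :|: [set j : 'I_m | i + j == s :> nat].
  apply/subsetP => j; rewrite !inE eq_sym => /andP[-> /orP[->//|/and3P[->]]].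
  by rewrite orbT.
move/subset_leq_card; have := (leq_card_setU (S i :\ i) [set j : 'I_m | i + j == s :> nat]).1.
have : #|[set j : 'I_m | i + j == s :> nat]| <= 1.
  apply/card_le1_eqP => j j'; rewrite !inE => /eqP h /eqP h'.
  by apply: val_inj => /=; lia.
have := cardsD1 i (S i); rewrite cS inE di /=; lia.
Qed.

Lemma near_regular_degree_ge i : r <= #|nbr near_regular i| + 1.
Proof.
have cS : #|S i| = r by rewrite card_add_mod_lt // ltnW.
have : S i :\ i \subset nbr near_regular i.
  by apply/subsetP => j; rewrite !inE eq_sym /near_regular => /andP[-> ->].
by move/subset_leq_card; have := cardsD1 i (S i); rewrite cS; lia.
Qed.

Lemma near_regular_degree_eq (i : 'I_m) : i != (r - 1) %/ 2 :> nat ->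
  r <= #|nbr near_regular i|.
Proof.
move=> ih; have cS : #|S i| = r by rewrite card_add_mod_lt // ltnW.
have sub : S i :\ i \subset nbr near_regular i.
  by apply/subsetP => j; rewrite !inE eq_sym /near_regular => /andP[-> ->].
have := subset_leq_card sub; have := cardsD1 i (S i); rewrite cS inE.
case: (ltnP ((i + i) %% m) r) => di /=; last by lia.
have im := ltn_ord i.
(* The partner of [i] is [s - i]; since [r <= s < m], it is not already a neighbour in the sum
   graph. *)
have [jm [ji [js sr]]] : s - i < m /\ s - i != i /\ i + (s - i) = s /\ (r <= s < m).
  move: di; rewrite double_mod_small // /s; case: ifP; lia.
have dj : (s - i + (s - i)) %% m < r.
  by move: di; rewrite !double_mod_small // /s; case: ifP; case: ifP; lia.
have : Ordinal jm |: (S i :\ i) \subset nbr near_regular i.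
  rewrite subUset sub andbT sub1set inE /near_regular /= js eqxx di dj orbT andbT.
  by rewrite -val_eqE /= eq_sym.
have pS : Ordinal jm \notin S i :\ i.
  by case/andP: sr => rs sm; rewrite in_setD1 inE /= js modn_small // ltnNge rs andbF.
by move/subset_leq_card; rewrite cardsU1 pS /= add1n => h1 -> _.
Qed.

Lemma near_regular_sum : m * r <= \sum_i #|nbr near_regular i| + 1.
Proof.
have hm : (r - 1) %/ 2 < m by lia.
rewrite (bigD1 (Ordinal hm)) //=.
have := near_regular_degree_ge (Ordinal hm).
have : \sum_(i < m | i != Ordinal hm) r <=
    \sum_(i < m | i != Ordinal hm) #|nbr near_regular i|.
  by apply: leq_sum => i ih; apply: near_regular_degree_eq.
have : m * r = r + \sum_(i < m | i != Ordinal hm) r.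
  by rewrite -[m in LHS]card_ord -sum_nat_const (bigD1 (Ordinal hm)).
move=> ->.
move: (\sum_(i < m | i != Ordinal hm) r) #|_|
  (\sum_(i < m | i != Ordinal hm) #|nbr near_regular i|); lia.
Qed.

End NearRegular.

(** * Degree sums of free graphs and disjoint unions *)

Definition realizable (b n D : nat) : Prop :=
  exists (T : finType) (e : rel T), [/\ symmetric e, irreflexive e,
    dstar_free b e, #|T| = n & D <= \sum_x #|nbr e x|].

Lemma card_nbrE (T : finType) (e : rel T) x : #|nbr e x| = \sum_y (e x y : nat).
Proof. by rewrite -sum1dep_card big_mkcond. Qed.

Lemma card_nbrUE (T : finType) (e : rel T) x x' :
  #|nbr e x :|: nbr e x'| = \sum_y (e x y || e x' y : nat).
Proof. by rewrite -sum1_card big_mkcond; apply: eq_bigr => y _; rewrite !inE; case: ifP. Qed.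

Lemma sum_neq (T : finType) (x : T) : \sum_y (x != y : nat) = #|T|.-1.
Proof.
rewrite -(cardC1 x) -sum1_card [RHS]big_mkcond; apply: eq_bigr => y _.
by rewrite inE eq_sym; case: (_ == _).
Qed.

Lemma realizable_small b n : n <= b + 4 -> realizable b n (n * n.-1).
Proof.
move=> nb; exists 'I_n, (fun i j => i != j); split=> //.
- by move=> i j; rewrite eq_sym.
- by move=> i; rewrite eqxx.
- by move=> u v _ _ _; apply: leq_trans (max_card _) _; rewrite card_ord.
- by rewrite card_ord.
- under eq_bigr => i _ do rewrite card_nbrE sum_neq card_ord.
  by rewrite sum_nat_const card_ord.
Qed.

(** No degree exceeds [b], so freeness is vacuous. The missing unit belongs to the one vertex that
    may have degree [b - 1]; parity recovers it in [realizable_le_ex]. *)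
Lemma realizable_regular b n : b < n -> realizable b n (n * b - 1).
Proof.
move=> bn; exists 'I_n, (@near_regular n b); split.
- exact: near_regular_sym.
- exact: near_regular_irr.
- by move=> u v _ _; rewrite ltnNge near_regular_degree_le.
- by rewrite card_ord.
- by rewrite leq_subLR addnC near_regular_sum.
Qed.

Lemma realizable_add b n n' D D' :
  realizable b n D -> realizable b n' D' -> realizable b (n + n') (D + D').
Proof.
move=> [T [e [sym irr free <- De]]] [T' [e' [sym' irr' free' <- De']]].
pose f (x y : T + T') := match x, y with
  | inl x, inl y => e x y | inr x, inr y => e' x y | _, _ => false end.
have dl x : #|nbr f (inl x)| = #|nbr e x|.
  by rewrite !card_nbrE big_sumType /= [X in _ + X]big1 ?addn0.
have dr x : #|nbr f (inr x)| = #|nbr e' x|.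
  by rewrite !card_nbrE big_sumType /= big1.
exists (T + T')%type, f; split.
- by move=> [x|x] [y|y] /=.
- by move=> [x|x] /=.
- move=> [u|u] [v|v] //= uv; rewrite ?dl ?dr => du dv.
    rewrite card_nbrUE big_sumType /= [X in _ + X]big1 // addn0 -card_nbrUE.
    exact: free.
  by rewrite card_nbrUE big_sumType /= big1 // -card_nbrUE; apply: free'.
- by rewrite card_sum.
- rewrite big_sumType /=; apply: leq_add; [apply: leq_trans De _ | apply: leq_trans De' _].
    by apply: leq_sum => x _; rewrite dl.
  by apply: leq_sum => x _; rewrite dr.
Qed.

Lemma realizable_copies b p n D :
  realizable b n D -> realizable b (p * (b + 4) + n) (p * ((b + 4) * (b + 3)) + D).
Proof.
move=> nD; elim: p => // p IH; rewrite !mulSn -(addnA (b + 4)).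
rewrite -(addnA ((b + 4) * _)); apply: realizable_add => //.
have -> : b + 3 = (b + 4).-1 by lia.
exact: realizable_small.
Qed.

(** * Graphs with one cluster *)

Section Cluster.
Variables (b k w m : nat) (h : rel 'I_w) (g : 'I_w -> 'I_m -> bool).
Hypotheses (hsym : symmetric h) (hirr : irreflexive h).
Hypotheses (kw : k + w = b + 2) (k0 : 0 < k).
Hypothesis hdeg : forall j, #|nbr h j| + 4 <= w.
Hypothesis grow : forall j, \sum_l (g j l : nat) = 2.
Hypothesis gcol : forall l, \sum_j (g j l : nat) + m <= b + 1.

Definition cluster_rel (x y : ('I_k + 'I_w) + 'I_m) : bool :=
  match x, y with
  | inl (inl i), inl (inl i') => i != i'
  | inl (inl _), inl (inr _) | inl (inr _), inl (inl _) => true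
  | inl (inr j), inl (inr j') => h j j'
  | inl (inr j), inr l | inr l, inl (inr j) => g j l
  | inr l, inr l' => l != l'
  | _, _ => false
  end.

Lemma cluster_sum (F : ('I_k + 'I_w) + 'I_m -> nat) :
  \sum_x F x = \sum_i F (inl (inl i)) + \sum_j F (inl (inr j)) + \sum_l F (inr l).
Proof. by rewrite !big_sumType. Qed.

Lemma cluster_degree_K i : #|nbr cluster_rel (inl (inl i))| = b + 1.
Proof.
rewrite card_nbrE cluster_sum /= sum_neq sum_nat_const !card_ord.
rewrite [X in _ + X]big1 //; lia.
Qed.

Lemma cluster_degree_W j : #|nbr cluster_rel (inl (inr j))| = k + #|nbr h j| + 2.
Proof.
by rewrite card_nbrE cluster_sum /= sum_nat_const !card_ord -card_nbrE grow muln1.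
Qed.

Lemma cluster_degree_B l :
  #|nbr cluster_rel (inr l)| = \sum_j (g j l : nat) + m.-1.
Proof.
by rewrite card_nbrE cluster_sum /= sum_neq card_ord big1.
Qed.

(** [hdeg] and [gcol] keep all degrees outside ['I_k] at most [b]. A vertex of ['I_k] sees all of
    ['I_k + 'I_w], and by [grow] a neighbour of it adds at most two vertices, which makes [b + 4].
    The [2 * w] edges of [g] count at both ends, hence [k + 4]. *)
Lemma realizable_cluster : realizable b (k + w + m)
  (k * (b + 1) + w * (k + 4) + \sum_j #|nbr h j| + m * m.-1).
Proof.
exists (('I_k + 'I_w) + 'I_m)%type, cluster_rel; split.
- by move=> [[x|x]|x] [[y|y]|y] //=; rewrite 1?eq_sym // hsym.
- by move=> [[x|x]|x] //=; rewrite ?eqxx ?hirr.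
- move=> u [[i|j]|l].
  + move=> uv _ _; rewrite card_nbrUE cluster_sum.
    have le1 (I : finType) (P : I -> bool) : \sum_x (P x : nat) <= #|I|.
      by rewrite -sum1_card; apply: leq_sum => x _; apply: leq_b1.
    have hK := le1 _ (fun i' => cluster_rel u (inl (inl i')) ||
      cluster_rel (inl (inl i)) (inl (inl i'))).
    have hW := le1 _ (fun j => cluster_rel u (inl (inr j)) ||
      cluster_rel (inl (inl i)) (inl (inr j))).
    have hB : \sum_l (cluster_rel u (inr l) || cluster_rel (inl (inl i)) (inr l) : nat) <= 2.
      case: u uv {hK hW} => [[i'|j]|l] //= _; first by rewrite big1.
      by rewrite -(grow j); apply: leq_sum => l _; rewrite orbF.
    rewrite !card_ord in hK hW; move: hK hW hB => /=; lia.
  + by rewrite cluster_degree_W; have := hdeg j; lia.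
  + by rewrite cluster_degree_B; have := gcol l; have := ltn_ord l; lia.
- by rewrite !card_sum !card_ord.
- rewrite cluster_sum.
  rewrite (eq_bigr _ (fun i _ => cluster_degree_K i)).
  rewrite (eq_bigr _ (fun j _ => cluster_degree_W j)).
  rewrite (eq_bigr _ (fun l _ => cluster_degree_B l)).
  rewrite !big_split /= exchange_big /= (eq_bigr _ (fun j _ => grow j)).
  rewrite !sum_nat_const !card_ord.
  nia.
Qed.

End Cluster.

Lemma realizable_le b n D D' : D' <= D -> realizable b n D -> realizable b n D'.
Proof.
move=> le [T [e [sym irr free cT De]]]; exists T, e; split=> //.
exact: leq_trans le De.
Qed.

Lemma near_regular_degree_le4 w j : 4 <= w ->
  #|nbr (@near_regular w (w - 4)) j| + 4 <= w.
Proof. by move=> w4; have := @near_regular_degree_le w (w - 4) ltac:(lia) j; lia. Qed.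

(** The two bounds of [one_cluster_value] balance at [k = 3]. Then [w = m = b - 1], and [g] is the
    incidence relation of a cycle, with two neighbours on either side. *)
Lemma realizable_q3 b : 5 <= b -> realizable b (2 * b + 1) (b * (2 * b + 1) + 2).
Proof.
move=> hb; have [m bE] : exists m, b = m.+1 by exists b.-1; lia.
have m4 : 4 <= m by lia.
pose g (j l : 'I_m) := (l == j) || (l == ordS j).
have ordS_neq (j : 'I_m) : j != ordS j.
  rewrite -val_eqE /=; have jm := ltn_ord j.
  by case: (ltngtP j.+1 m) => h; [rewrite modn_small | | rewrite h modnn]; lia.
have grow j : \sum_l (g j l : nat) = 2.
  have <- : #|[set j; ordS j]| = 2 by rewrite cards2 ordS_neq.
  rewrite -sum1_card [RHS]big_mkcond.
  by apply: eq_bigr => l _; rewrite !inE /g; case: ifP.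
have gcol l : \sum_j (g j l : nat) + m <= b + 1.
  suff : \sum_j (g j l : nat) <= 2 by lia.
  apply: leq_trans (_ : #|[set l; ord_pred l]| <= 2); last by rewrite cards2; case: (_ != _).
  rewrite -sum1_card [leqRHS]big_mkcond; apply: leq_sum => j _; rewrite !inE /g.
  by rewrite [j == l]eq_sym; case: eqP => //= _; case: eqP => // ->; rewrite ordSK eqxx.
have H := realizable_cluster (@near_regular_sym m (m - 4)) (@near_regular_irr m (m - 4))
  (_ : 3 + m = b + 2) isT (fun j => near_regular_degree_le4 j m4) grow gcol.
rewrite (_ : 2 * b + 1 = 3 + m + m); last by lia.
apply: realizable_le (H _); last by lia.
have := @near_regular_sum m (m - 4) ltac:(lia).
move: (\sum_j _) => S hS; rewrite bE.
have [d dE] : exists d, m = d + 4 by exists (m - 4); lia.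
by clear - hS dE; subst m; nia.
Qed.

(** With [m = b], a vertex of the clique can have only one neighbour through [g]. Pairing the
    vertices of the clique serves [w = b %/ 2] vertices; for odd [b] one is left over. *)
Lemma realizable_q2 b : 8 <= b ->
  realizable b (2 * b + 2) (b * (2 * b + 2) + 1 + b %/ 2).
Proof.
move=> hb; set w := b %/ 2; have w4 : 4 <= w by rewrite /w; lia.
pose g (j : 'I_w) (l : 'I_b) := l %/ 2 == j.
have grow j : \sum_l (g j l : nat) = 2.
  have jw : j < b %/ 2 := ltn_ord j.
  have h0 : j.*2 < b by lia.
  have h1 : j.*2.+1 < b by lia.
  have -> : 2 = #|[set Ordinal h0; Ordinal h1]| by rewrite cards2 -val_eqE /= ; lia.
  rewrite -sum1_card [RHS]big_mkcond; apply: eq_bigr => l _.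
  rewrite !inE /g -!val_eqE /=.
  by case: eqP; case: eqP; case: eqP => //=; lia.
have gcol l : \sum_j (g j l : nat) + b <= b + 1.
  rewrite addnC leq_add2l.
  apply: leq_trans (_ : #|[set j | g j l]| <= 1).
    by rewrite -sum1dep_card [leqRHS]big_mkcond; apply: leq_sum => j _; case: ifP.
  apply/card_le1_eqP => j j'; rewrite !inE /g => /eqP h /eqP h'.
  by apply: val_inj; rewrite /= -h.
have H := realizable_cluster (@near_regular_sym w (w - 4)) (@near_regular_irr w (w - 4))
  (_ : b + 2 - w + w = b + 2) (_ : 0 < b + 2 - w)
  (fun j => near_regular_degree_le4 j w4) grow gcol.
rewrite (_ : 2 * b + 2 = b + 2 - w + w + b); last by rewrite /w; lia.
apply: realizable_le (H _ _); [| rewrite /w; lia | rewrite /w; lia].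
have := @near_regular_sum w (w - 4) ltac:(lia).
move: (\sum_j _) => S hS.
have [d dE] : exists d, w = d + 4 by exists (w - 4); lia.
have [k kE] : exists k, b = w + k /\ w <= k by exists (b - w); rewrite /w; lia.
have -> : b + 2 - w = k + 2 by lia.
have bE : b * b.-1 = b * b - b by rewrite -subn1 mulnBr muln1.
rewrite bE; move: w dE hS kE {H grow gcol g w4 bE} => w -> hS [bE _].
rewrite bE in hb *; nia.
Qed.

(** * Both bounds on the extremal number *)

Lemma realizable_le_ex b n D E : realizable b n D -> 2 * E <= D + 1 ->
  E <= ex n (double_star 3 b).
Proof.
move=> [T [e [sym irr free <- De]]] hE.
pose e' : rel 'I_#|T| := fun i j => e (enum_val i) (enum_val j).
have irr' : irreflexive e' by move=> i; apply: irr.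
have sym' : symmetric e' by move=> i j; apply: sym.
have nE i : [set enum_val j | j in nbr e' i] = nbr e (enum_val i).
  apply/setP => y; rewrite inE; apply/imsetP/idP => [[j]|iy].
    by rewrite inE => ij ->.
  by exists (enum_rank y); rewrite ?inE /e' enum_rankK.
have cE i : #|nbr e' i| = #|nbr e (enum_val i)|.
  by rewrite -nE card_imset //; apply: enum_val_inj.
have nG i : nbr (adj (graph_of irr')) i = nbr e' i.
  by apply/setP => j; rewrite !inE -(adj_graph_of irr' sym').
apply: leq_trans (_ : #|edges (graph_of irr')| <= _).
  (* The degree sum is even, so an odd lower bound [D] may be raised by one. *)
  have := adj_handshake (graph_of irr').
  have -> : \sum_i #|nbr (adj (graph_of irr')) i| = \sum_x #|nbr e x|; last by lia.
  rewrite [RHS](reindex (@enum_val T predT)) /=; last exact/onW_bij/enum_val_bij.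
  by apply: eq_bigr => i _; rewrite nG cE.
apply: leq_bigmax_cond; apply: dstar_free_is_free => u v.
rewrite adj_graph_of // !nG !cE => uv du dv.
by rewrite -(card_imset _ enum_val_inj) imsetU !nE; apply: free.
Qed.

Lemma ex_le_value n b p q : 3 < b -> 0 < p -> n = p * (b + 4) + q -> q <= b + 3 ->
  ex n (double_star 3 b) <= dstar_value b p q.
Proof.
case: p => // p hb _ nE hq; apply/bigmax_leqP => G /is_free_dstar_free free.
have := half_sum_degree_le_value (@adj_sym _ G) (@adj_irr _ G) hb free _ hq.
by rewrite adj_handshake mulKn // => /(_ p); rewrite card_ord; apply.
Qed.

Lemma value_le_ex n b p q : 3 < b -> 0 < p -> n = p * (b + 4) + q -> q <= b + 3 ->
  dstar_value b p q <= ex n (double_star 3 b).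
Proof.
case: p => // p hb _ -> hq; rewrite dstar_value_eq //=.
have cC := double_bin2 (b + 4).
rewrite mulSn [b + 4 + _]addnC -addnA.
(* [p] copies of the complete graph split off, so only the remaining [b + 4 + q] vertices need a
   construction. *)
have reduce D E : realizable b (b + 4 + q) D -> 2 * E <= D + 1 ->
    p * 'C(b + 4, 2) + E <= ex (p * (b + 4) + (b + 4 + q)) (double_star 3 b).
  by move=> /(realizable_copies p) real hE; apply: (realizable_le_ex real); nia.
rewrite /dstar_value subnn mul0n add0n mul1n.
case: ifP => [h | _].
  by apply: reduce (realizable_regular _) _; nia.
case: ifP => [/andP[h1 /eqP h2] | _].
  apply: (reduce (b * (2 * b + 1) + 2)); last by lia.
  by have := @realizable_q3 b ltac:(lia); congr realizable; lia.
case: ifP => [/andP[h1 /eqP h2] | _].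
  apply: (reduce (b * (2 * b + 2) + 1 + b %/ 2)); last by lia.
  by have := @realizable_q2 b ltac:(lia); congr realizable; lia.
apply: reduce (realizable_add (@realizable_small b (b + 4) (leqnn _))
  (@realizable_small b q _)) _; first by lia.
have := double_bin2 q; nia.
Qed.

Theorem theorem1p5 (n b p q : nat) (hb : 3 < b) (hn : b + 5 <= n)
    (hnpq : n = p * (b + 4) + q) (hq : q <= b + 3) :
  ex n (double_star 3 b) =
    if [|| (24 <= b) && (4 <= q <= b - 4),
           (16 <= b <= 23) && (5 <= q <= b - 4)
         | (14 <= b <= 15) && (6 <= q <= b - 5)]
    then (p - 1) * 'C(b + 4, 2) + (b * (b + 4 + q)) %/ 2
    else if (22 <= b) && (q == b - 3)
    then (p - 1) * 'C(b + 4, 2) + (b * (2 * b + 1) + 3) %/ 2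
    else if (34 <= b) && (q == b - 2)
    then (p - 1) * 'C(b + 4, 2) + (b * (2 * b + 2) + 2 + b %/ 2) %/ 2
    else p * 'C(b + 4, 2) + 'C(q, 2).
Proof.
(* With [p = 0], [n = q <= b + 3] would contradict [hn]. *)
have p0 : 0 < p by case: p hnpq => //; lia.
by apply/eqP; rewrite eqn_leq ex_le_value // value_le_ex.
Qed.
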